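(* Fix an integer $r\ge1$, a partition $\lambda=(\lambda_1,\dots,\lambda_k)$ with $k\le r$, and a partition $\mu=(\mu_1,\dots,\mu_l)$. Then there is a polynomial $A^{\lambda,\mu}_{(r)}(x)\in\mathbb Q[x]$ such that $$n!\cdot N^\bullet_{n-\lambda_1,\dots,n-\lambda_k,n,\dots,n}\big((\mu_1,\dots,\mu_l,1^{n-|\mu|})\big)=A^{\lambda,\mu}_{(r)}(n)$$ for every positive integer $n$ with $n\ge|\mu|$, where the subscript consists of $r$ entries, the last $r-k$ of which equal $n$.
   Context: For a partition $\nu$ of $d$ and integers $k_1,\dots,k_r$, $N^\bullet_{k_1,\dots,k_r}(\nu)=\frac{1}{d!}\#\{(\alpha_1,\dots,\alpha_r,\alpha)\in(S_d)^{r+1}:\alpha_1\cdots\alpha_r\alpha=e,\ \alpha_i\text{ has exactly }k_i\text{ cycles (fixed points counted)},\ \alpha\text{ has cycle type }\nu\}$ (so it is $0$ if no such tuples exist); equivalently the automorphism-weighted count of possibly disconnected degree-$d$ branched covers of $\mathbb{CP}^1$ over $r+1$ points with $k_i$ preimages over the $i$-th point and profile $\nu$ over the last. $(\mu_1,\dots,\mu_l,1^{n-|\mu|})$ denotes the partition of $n$ obtained from $\mu$ by appending $n-|\mu|$ parts equal to $1$. *)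

(* Defs.v *)
From HB Require Import structures.
From mathcomp Require Import all_boot all_order all_algebra fingroup perm.

Set Implicit Arguments.
Unset Strict Implicit.
Unset Printing Implicit Defensive.

Import Order.TTheory GRing.Theory Num.Theory.
Local Open Scope ring_scope.

Definition is_partition (nu : seq nat) : bool :=
  sorted geq nu && all (leq 1) nu.

Definition ncycles (d : nat) (s : 'S_d) : nat := #|porbits s|.

Definition cycle_type (d : nat) (s : 'S_d) : seq nat :=
  sort geq [seq #|pred_of_set X| | X <- enum (porbits s)].

(* MathComp composes permutations left to right; inverting all the entries maps
   these tuples bijectively onto the ones for right-to-left composition. *)
Definition factorizations (d r : nat) (k : 'I_r -> int) (nu : seq nat) :
    {set {ffun 'I_r -> 'S_d} * 'S_d} :=
  [set p : {ffun 'I_r -> 'S_d} * 'S_d |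
    [&& ((\prod_(i < r) p.1 i) * p.2 == 1)%g,
        [forall i : 'I_r, (ncycles (p.1 i))%:Z == k i]
      & cycle_type p.2 == nu]].

Definition Nbullet (d r : nat) (k : 'I_r -> int) (nu : seq nat) : rat :=
  #|factorizations d k nu|%:R / (d`!)%:R.

(* The r entries n - lambda_1, ..., n - lambda_k, n, ..., n; they are integers,
   so n - lambda_i may be negative. *)
Definition cycle_counts (r n : nat) (lam : seq nat) (i : 'I_r) : int :=
  if (i < size lam)%N then n%:Z - (nth 0%N lam i)%:Z else n%:Z.

Definition pad_ones (n : nat) (mu : seq nat) : seq nat :=
  mu ++ nseq (n - sumn mu) 1%N.

(* Main.v *)
(* A permutation of n points with n - c cycles moves at most 2c points, so the
   supports of the factors of a tuple lie together in a set of at most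
   M = 2 (lambda_1 + ... + lambda_k) points.  The cycle counts n - lambda_i and
   the type (mu, 1^(n-|mu|)) depend only on the cycles of length at least 2,
   which do not change when a permutation is restricted to a set containing its
   support.  Hence the number of tuples with joint support A depends only on
   j = #|A|, not on n; calling it g(j), the count is the sum over j <= M of
   binomial(n, j) g(j), which is polynomial in n. *)

Require Import Defs.
From mathcomp Require Import all_boot all_order all_algebra fingroup perm zify.

Set Implicit Arguments.
Unset Strict Implicit.
Unset Printing Implicit Defensive.

Import Order.TTheory GRing.Theory Num.Theory.
Local Open Scope ring_scope.

(** * Partitions up to parts equal to 1, and cycles of length at least 2 *)

Section ReducedCycleType.

Local Open Scope nat_scope.

Lemma geq_trans : transitive geq.
Proof. by move=> x y z /= xy yz; exact: leq_trans yz xy. Qed.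

Lemma geq_anti : antisymmetric geq.
Proof. by move=> x y; rewrite /= andbC -eqn_leq => /eqP. Qed.

Lemma geq_total : total geq.
Proof. by move=> x y; exact: leq_total. Qed.

(** Up to order, a partition is its parts greater than 1 followed by ones, and the sum determines
    how many ones there are. *)
Lemma partition_eq (a b : seq nat) :
  is_partition a -> is_partition b -> sumn a = sumn b ->
  [seq x <- a | 1 < x] = [seq x <- b | 1 < x] -> a = b.
Proof.
move=> /andP[sa pa] /andP[sb pb] sum_eq fil_eq.
apply: (sorted_eq geq_trans geq_anti sa sb).
have decomp c : all (leq 1) c ->
    perm_eq c ([seq x <- c | 1 < x] ++ nseq (count (predC (ltn 1)) c) 1).
  move=> pc; have /all_pred1P E : all (pred1 1) [seq x <- c | predC (ltn 1) x].
    apply/allP => x; rewrite mem_filter /= => /andP[x1 xc].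
    by have := allP pc _ xc; lia.
  by rewrite -size_filter -E perm_sym perm_filterC.
have Da := decomp _ pa; have Db := decomp _ pb.
move: (perm_sumn Da) (perm_sumn Db).
rewrite !sumn_cat !sumn_nseq sum_eq !mul1n fil_eq => -> /addnI count_eq.
by apply: (perm_trans Da); rewrite perm_sym fil_eq count_eq.
Qed.

Lemma pad_ones_partition n mu : is_partition mu -> is_partition (pad_ones n mu).
Proof.
case/andP=> smu pmu; apply/andP; split; last first.
  by rewrite all_cat pmu; apply/allP => x /nseqP[->].
rewrite (sorted_pairwise geq_trans) pairwise_cat -!(sorted_pairwise geq_trans).
rewrite smu /=; apply/andP; split.
  by apply/allrelP => x y xmu /nseqP[-> _]; exact: (allP pmu).
rewrite (sorted_pairwise geq_trans).
by apply/(pairwiseP 0) => i j; rewrite !inE size_nseq !nth_nseq => -> ->.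
Qed.

Variable T : finType.
Implicit Type s : {perm T}.

Definition nontrivial_cycles s := [set X in porbits s | 1 < #|X|].

(** Unlike [cycle_type], this does not change when fixed points are added to the permuted set. *)
Definition reduced_type s : seq nat :=
  sort geq [seq #|pred_of_set X| | X <- enum (nontrivial_cycles s)].

Lemma sumn_sort_cards (f : nat -> nat) (A : {set {set T}}) :
  sumn [seq f x | x <- sort geq [seq #|pred_of_set X| | X <- enum A]] =
  \sum_(X in A) f #|X|.
Proof.
have /perm_sumn -> := perm_map f (permEl (perm_sort geq
  [seq #|pred_of_set X| | X <- enum A])).
by rewrite sumnE !big_map big_enum.
Qed.

Lemma porbits_partition s : partition (porbits s) [set: T].
Proof.
apply/and3P; split.
- apply/eqP/setP => x; rewrite inE; apply/bigcupP.
  by exists (porbit s x); [exact: imset_f | exact: porbit_id].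
- apply/trivIsetP => _ _ /imsetP[x _ ->] /imsetP[y _ ->].
  apply: contraNT => /pred0Pn[z /andP[/= zx zy]].
  move: zx zy; rewrite porbit_sym -eq_porbit_mem => /eqP ->.
  by rewrite porbit_sym -eq_porbit_mem => /eqP ->.
- apply/negP => /imsetP[x _ /setP/(_ x)].
  by rewrite inE porbit_id.
Qed.

(** A cycle of length c covers 1 + (c - 1) points, and fixed points add nothing to the second term.
    So a prescribed cycle count becomes a condition on [reduced_type]. *)
Lemma card_porbits s :
  #|porbits s| + sumn [seq x.-1 | x <- reduced_type s] = #|T|.
Proof.
rewrite sumn_sort_cards -cardsT (card_partition (porbits_partition s)).
under eq_bigl => X do rewrite inE.
rewrite -sum1_card big_mkcondr -big_split /=.
apply: eq_bigr => _ /imsetP[x _ ->].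
have : 0 < #|porbit s x| by apply/card_gt0P; exists x; exact: porbit_id.
by move: #|porbit s x| => c; case: (ltnP 1 c); lia.
Qed.

Definition support s := [set x | s x != x].

(** The moved points lie in the nontrivial cycles, and c <= 2(c - 1) for a cycle of length c >=
    2. *)
Lemma support_card s :
  #|support s| <= 2 * sumn [seq x.-1 | x <- reduced_type s].
Proof.
have sub : support s \subset cover (nontrivial_cycles s).
  apply/subsetP => x; rewrite inE => sx; apply/bigcupP.
  exists (porbit s x); last exact: porbit_id.
  (* The orbit of a moved point [x] contains the two distinct points [x] and [s x]. *)
  rewrite inE imset_f //= (cardD1 x) porbit_id (cardD1 (s x)) !inE sx.
  by have := mem_porbit s 1 x; rewrite expg1 => ->.
apply: leq_trans (subset_leq_card sub) _.
apply: leq_trans (leq_card_cover _) _.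
rewrite sumn_sort_cards big_distrr /=; apply: leq_sum => X.
by rewrite inE => /andP[_]; lia.
Qed.

End ReducedCycleType.

(** * Cycle types of permutations of n points *)

Section CycleType.

Local Open Scope nat_scope.

Variables (n : nat) (s : 'S_n).

Lemma filter_cycle_type : [seq x <- cycle_type s | 1 < x] = reduced_type s.
Proof.
rewrite (filter_sort geq_total geq_trans) filter_map.
apply/(perm_sortP geq_total geq_trans geq_anti)/perm_map/uniq_perm.
- exact/filter_uniq/enum_uniq.
- exact: enum_uniq.
by move=> X; rewrite mem_filter !mem_enum !inE andbC.
Qed.

Lemma cycle_type_partition : is_partition (cycle_type s).
Proof.
rewrite /is_partition (sort_sorted geq_total) all_sort.
apply/allP => _ /mapP[X + ->]; rewrite mem_enum => /imsetP[x _ ->].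
by apply/card_gt0P; exists x; exact: porbit_id.
Qed.

Lemma sumn_cycle_type : sumn (cycle_type s) = n.
Proof.
have := sumn_sort_cards id (porbits s); rewrite map_id => ->.
by rewrite -(card_partition (porbits_partition s)) cardsT card_ord.
Qed.

(** Both sequences are partitions of n, the padded one because [sumn mu <= n], so [partition_eq]
    reduces equality to the parts greater than 1. *)
Lemma cycle_type_pad_ones mu : is_partition mu -> sumn mu <= n ->
  (cycle_type s == pad_ones n mu) =
  (reduced_type s == [seq x <- mu | 1 < x]).
Proof.
move=> pmu le_mu.
have fil_pad : [seq x <- pad_ones n mu | 1 < x] = [seq x <- mu | 1 < x].
  by rewrite filter_cat filter_nseq cats0.
apply/eqP/eqP => [eq_s | eq_r]; first by rewrite -filter_cycle_type eq_s.
apply: partition_eq cycle_type_partition (pad_ones_partition _ pmu) _ _.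
  by rewrite sumn_cycle_type sumn_cat sumn_nseq mul1n subnKC.
by rewrite filter_cycle_type fil_pad.
Qed.

End CycleType.

(** * Extending permutations along an injection by the identity off its image *)

Section Extension.

Variables (T U : finType) (f : T -> U).
Hypothesis f_inj : injective f.
Implicit Types s t : {perm T}.

Definition extend_fun s (y : U) : U :=
  if [pick x | f x == y] is Some x then f (s x) else y.

Lemma extend_fun_im s x : extend_fun s (f x) = f (s x).
Proof.
rewrite /extend_fun; case: pickP => [z /eqP/f_inj -> // | /(_ x)].
by rewrite eqxx.
Qed.

Lemma extend_fun_notin s y : y \notin codom f -> extend_fun s y = y.
Proof.
rewrite /extend_fun; case: pickP => [z /eqP <- | //].
by rewrite codom_f.
Qed.

Lemma extend_fun_inj s : injective (extend_fun s).
Proof.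
move=> y z; have [/codomP[x ->]|ny] := boolP (y \in codom f);
  have [/codomP[w ->]|nz] := boolP (z \in codom f);
  rewrite ?extend_fun_im ?extend_fun_notin //.
- by move/f_inj/perm_inj ->.
- by move=> E; rewrite -E codom_f in nz.
- by move=> E; rewrite E codom_f in ny.
Qed.

Definition extend s : {perm U} := perm (@extend_fun_inj s).

Lemma extend_im s x : extend s (f x) = f (s x).
Proof. by rewrite permE extend_fun_im. Qed.

Lemma extend_notin s y : y \notin codom f -> extend s y = y.
Proof. by move=> ny; rewrite permE extend_fun_notin. Qed.

Lemma extend_inj : injective extend.
Proof.
by move=> s t E; apply/permP => x; apply: f_inj; rewrite -!extend_im E.
Qed.

Lemma extendM s t : extend (s * t)%g = (extend s * extend t)%g.
Proof.
apply/permP => y; rewrite permM.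
have [/codomP[x ->]|ny] := boolP (y \in codom f).
  by rewrite !extend_im permM.
by rewrite !extend_notin.
Qed.

Lemma extend1 : extend 1%g = 1%g.
Proof. by apply: (mulgI (extend 1)); rewrite -extendM !mulg1. Qed.

Lemma extendV s : extend s^-1%g = (extend s)^-1%g.
Proof. by apply: (mulgI (extend s)); rewrite -extendM !mulgV extend1. Qed.

Lemma extendX s k : extend (s ^+ k)%g = (extend s ^+ k)%g.
Proof.
by elim: k => [|k IHk]; rewrite ?expg0 ?extend1 // !expgS extendM IHk.
Qed.

Lemma extend_prod (I : Type) (r : seq I) (F : I -> {perm T}) :
  extend (\prod_(i <- r) F i)%g = (\prod_(i <- r) extend (F i))%g.
Proof. exact: (big_morph extend extendM extend1). Qed.

Lemma support_extend s : support (extend s) = f @: support s.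
Proof.
apply/setP => y; rewrite inE; have [/codomP[x ->]|ny] := boolP (y \in codom f).
  by rewrite extend_im mem_imset // inE (inj_eq f_inj).
rewrite extend_notin // eqxx; apply/esym/negP => /imsetP[x _ E].
by rewrite E codom_f in ny.
Qed.

(** Such a [u] maps the image of [f] to itself, so it can be pulled back along [f]. *)
Lemma extend_surj (u : {perm U}) :
  support u \subset codom f -> exists s, u = extend s.
Proof.
move=> sub; have uf x : u (f x) \in codom f.
  (* A moved point is sent to a moved point, by injectivity of [u]; an unmoved point stays in the
     image. *)
  have [ufx | ux] := boolP (f x \in support u); last first.
    by move: ux; rewrite inE negbK => /eqP ->; rewrite codom_f.
  by apply: (subsetP sub); move: ufx; rewrite !inE (inj_eq perm_inj).
have g_inj : injective (fun x => iinv (uf x)).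
  by move=> x y /(congr1 f); rewrite !f_iinv => /perm_inj/f_inj.
exists (perm g_inj); apply/permP => y.
have [/codomP[x ->]|ny] := boolP (y \in codom f).
  by rewrite extend_im permE f_iinv.
rewrite extend_notin //; apply/eqP; apply: contraNT ny => uy.
by apply: (subsetP sub); rewrite inE.
Qed.

Lemma porbit_extend s x : porbit (extend s) (f x) = f @: porbit s x.
Proof.
apply/setP => y; apply/porbitP/imsetP => [[k ->] | [_ /porbitP[k ->] ->]].
  by rewrite -extendX extend_im; exists ((s ^+ k)%g x); first exact: mem_porbit.
by exists k; rewrite -extendX extend_im.
Qed.

(** Orbits inside the image of [f] are images of orbits of [s]; all others are singletons. *)
Lemma nontrivial_cycles_extend s :
  nontrivial_cycles (extend s) =
  [set f @: (X : {set T}) | X in nontrivial_cycles s].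
Proof.
apply/setP => Y; rewrite inE; apply/andP/imsetP.
  case=> /imsetP[y _ ->]; have [/codomP[x ->]|ny] := boolP (y \in codom f).
    rewrite porbit_extend card_imset // => card_x; exists (porbit s x) => //.
    by rewrite inE imset_f.
  suff -> : porbit (extend s) y = [set y] by rewrite cards1.
  apply/setP => z; rewrite inE; apply/porbitP/eqP => [[k ->] | ->].
    by rewrite -extendX extend_notin.
  by exists 0%N; rewrite expg0 perm1.
case=> X; rewrite inE => /andP[/imsetP[x _ ->] card_x] ->.
by rewrite -porbit_extend imset_f // porbit_extend card_imset.
Qed.

Lemma reduced_type_extend s : reduced_type (extend s) = reduced_type s.
Proof.
apply/(perm_sortP geq_total geq_trans geq_anti).
have -> : [seq #|pred_of_set X| | X <- enum (nontrivial_cycles s)] =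
    [seq #|pred_of_set X| |
      X <- [seq f @: (Y : {set T}) | Y <- enum (nontrivial_cycles s)]].
  by rewrite -map_comp; apply: eq_map => X /=; rewrite card_imset.
apply/perm_map/uniq_perm; first exact: enum_uniq.
  by rewrite map_inj_uniq ?enum_uniq //; exact: imset_inj.
move=> Y; rewrite mem_enum nontrivial_cycles_extend.
apply/imsetP/mapP => -[X XP ->]; exists X => //.
  by rewrite mem_enum.
by rewrite -mem_enum.
Qed.

End Extension.

(** * Counting tuples by their joint support *)

Section Counting.

Variables (r : nat) (lam nu : seq nat).

(** The conditions on a factorization once its last entry is eliminated as the inverse of the
    product; they make sense on any finite set. *)
Definition admissible (T : finType) (w : {ffun 'I_r -> {perm T}}) : bool :=
  [forall i : 'I_r,
     sumn [seq x.-1 | x <- reduced_type (w i)] == nth 0%N lam i]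
  && (reduced_type (\prod_(i < r) w i)^-1%g == nu).

(** The eliminated last entry moves no point outside this union. *)
Definition tuple_support (T : finType) (w : {ffun 'I_r -> {perm T}}) :=
  \bigcup_(i < r) support (w i).

(** The number g(j), computed on a standard set of j points. *)
Definition full_count (j : nat) : nat :=
  #|[set w : {ffun 'I_r -> 'S_j} | admissible w && (tuple_support w == setT)]|.

(** Entrywise extension along [f] is injective, preserves admissibility and carries the joint
    support to its image. *)
Lemma card_admissible_support (T U : finType) (f : T -> U) :
  injective f ->
  #|[set w : {ffun 'I_r -> {perm U}} |
      admissible w && (tuple_support w == f @: setT)]| =
  #|[set w : {ffun 'I_r -> {perm T}} |
      admissible w && (tuple_support w == setT)]|.
Proof.
move=> f_inj; pose ext (w : {ffun 'I_r -> {perm T}}) :=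
  [ffun i => extend f_inj (w i)].
have ext_inj : injective ext.
  move=> v w /ffunP E; apply/ffunP => i; have := E i.
  by rewrite !ffunE => /extend_inj.
have adm_ext w : admissible (ext w) = admissible w.
  congr (_ && _).
    by apply: eq_forallb => i; rewrite ffunE reduced_type_extend.
  rewrite -(reduced_type_extend f_inj) extendV extend_prod.
  by under eq_bigr do rewrite ffunE.
have supp_ext w : tuple_support (ext w) = f @: tuple_support w.
  rewrite /tuple_support.
  under eq_bigr do rewrite ffunE support_extend.
  by rewrite (big_morph (fun A : {set T} => f @: A) (imsetU f) (imset0 f)).
rewrite -(card_imset _ ext_inj); apply: eq_card => w; rewrite inE.
apply/andP/imsetP => [[adm /eqP supp] | [v]]; last first.
  by rewrite inE => /andP[adm /eqP supp] ->; rewrite adm_ext supp_ext supp.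
(* Surjectivity: each entry is supported in the image of [f], hence is an extension. *)
have /fin_all_exists[v vE] : forall i, exists s, w i = extend f_inj s.
  move=> i; apply: extend_surj; apply/subsetP => x xi.
  have : x \in tuple_support w by apply/bigcupP; exists i.
  by rewrite supp => /imsetP[y _ ->]; exact: codom_f.
have wE : w = ext (finfun v) by apply/ffunP => i; rewrite !ffunE.
exists (finfun v) => //; rewrite inE -adm_ext -wE adm.
by apply/eqP/(imset_inj f_inj); rewrite -supp_ext -wE supp.
Qed.

Lemma tuple_support_card (T : finType) (w : {ffun 'I_r -> {perm T}}) :
  admissible w -> (#|tuple_support w| <= \sum_(i < r) 2 * nth 0 lam i)%N.
Proof.
case/andP=> /forallP lamE _.
apply: (@leq_trans (\sum_(i < r) #|support (w i)|)).
  rewrite /tuple_support; elim/big_ind2: _ => [|A a B b leA leB|//].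
    by rewrite cards0.
  by apply: leq_trans (leq_card_setU _ _) _; exact: leq_add.
by apply: leq_sum => i _; rewrite -(eqP (lamE i)) support_card.
Qed.

Lemma card_admissible (n : nat) :
  #|[set w : {ffun 'I_r -> 'S_n} | admissible w]| =
  (\sum_(j < (\sum_(i < r) 2 * nth 0 lam i).+1) 'C(n, j) * full_count j)%N.
Proof.
set M := (\sum_(i < r) _)%N.
rewrite -sum1dep_card.
(* Admissible tuples move at most [M] points, so [inord] returns the true size of the support. *)
rewrite (partition_big (fun w => inord #|tuple_support w| : 'I_M.+1) xpredT) //.
apply: eq_bigr => j _.
(* The binomial coefficient counts the j-subsets [A]; it remains to see that each is the support of
   g(j) tuples. *)
rewrite -[in RHS](card_ord n) -card_draws -sum_nat_const.
rewrite (partition_big (@tuple_support _)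
  (fun A : {set 'I_n} => A \in [set A : {set 'I_n} | #|A| == j])); last first.
  move=> w /andP[adm /eqP <-]; rewrite inE inordK //.
  by rewrite ltnS tuple_support_card.
apply: eq_bigr => A; rewrite inE => /eqP cardA.
(* Enumerating [A] gives an injection of the standard j-point set with image [A]. *)
pose f (i : 'I_j) : 'I_n := enum_val (cast_ord (esym cardA) i).
have f_inj : injective f by move=> x y /enum_val_inj/cast_ord_inj.
have fA : f @: setT = A.
  apply/eqP; rewrite eqEcard card_imset // cardsT card_ord cardA leqnn andbT.
  by apply/subsetP => _ /imsetP[x _ ->]; exact: enum_valP.
rewrite sum1dep_card /full_count -(card_admissible_support f_inj) fA.
apply: eq_card => w; rewrite !inE.
have [/eqP E | _] := boolP (tuple_support w == A); last by rewrite !andbF.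
by rewrite E cardA inord_val eqxx !andbT.
Qed.

(** The relation forces the last entry to be the inverse of the product, so a factorization is
    determined by its first r entries. *)
Lemma card_factorizations (n : nat) (mu : seq nat) :
  is_partition mu -> (sumn mu <= n)%N ->
  nu = [seq x <- mu | (1 < x)%N] ->
  #|factorizations n (cycle_counts (r := r) n lam) (pad_ones n mu)| =
  #|[set w : {ffun 'I_r -> 'S_n} | admissible w]|.
Proof.
move=> pmu le_mu nuE.
pose h (w : {ffun 'I_r -> 'S_n}) := (w, (\prod_(i < r) w i)^-1%g).
have h_inj : injective h by move=> v w [].
rewrite -(card_imset _ h_inj); apply: eq_card => -[w s].
have lamP (i : 'I_r) :
    ((ncycles (w i))%:Z == cycle_counts n lam i) =
    (sumn [seq x.-1 | x <- reduced_type (w i)] == nth 0%N lam i).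
  have := card_porbits (w i); rewrite card_ord => cE.
  (* The default 0 of [nth] past the end of [lam] matches the entries equal to n. *)
  have -> : cycle_counts n lam i = n%:Z - (nth 0%N lam i)%:Z.
    by rewrite /cycle_counts; case: ltnP => // le_i; rewrite nth_default // subr0.
  by rewrite /ncycles; apply/eqP/eqP; lia.
rewrite inE /= (eq_forallb lamP) cycle_type_pad_ones // -nuE.
apply/and3P/imsetP => [[/eqP ws lamw nus] | [v + [-> ->]]]; last first.
  by rewrite inE => /andP[lamv nuv]; rewrite mulgV eqxx.
have sE : s = (\prod_(i < r) w i)^-1%g.
  by apply: (mulgI (\prod_(i < r) w i)%g); rewrite ws mulgV.
by exists w; rewrite ?inE /h -?sE // /admissible -sE lamw.
Qed.

End Counting.

(** * Binomial coefficients as polynomials, and the conclusion *)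

Definition binomial_poly (j : nat) : {poly rat} :=
  (j`!%:R)^-1 *: \prod_(i < j) ('X - i%:R%:P).

Lemma binomial_polyE (j n : nat) : (binomial_poly j).[n%:R] = 'C(n, j)%:R.
Proof.
have ffactE : (\prod_(i < j) ('X - i%:R%:P) : {poly rat}).[n%:R] = (n ^_ j)%:R.
  elim: j => [|j IHj]; first by rewrite big_ord0 hornerC.
  rewrite big_ord_recr hornerM {}IHj hornerXsubC ffactnSr natrM.
  (* Truncated subtraction differs from the rational one only for n < j, where the falling factorial
     is already 0. *)
  have [lt_nj | le_jn] := ltnP n j; last by rewrite natrB.
  by rewrite ffact_small // !mul0r.
rewrite hornerZ ffactE -bin_ffact natrM mulrC mulfK //.
by rewrite pnatr_eq0 -lt0n fact_gt0.
Qed.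

Theorem theorem4p1 (r : nat) (lam mu : seq nat)
    (hr : (1 <= r)%N)
    (hlam : is_partition lam) (hlamr : (size lam <= r)%N)
    (hmu : is_partition mu) :
  exists A : {poly rat},
    forall n : nat, (0 < n)%N -> (sumn mu <= n)%N ->
      (n`!)%:R * Nbullet n (cycle_counts (r := r) n lam) (pad_ones n mu)
        = A.[n%:R].
Proof.
(* Neither the range of summation nor the coefficients g(j) involve n. *)
exists (\sum_(j < (\sum_(i < r) 2 * nth 0 lam i).+1)
  (full_count r lam [seq x <- mu | (1 < x)%N] j)%:R *: binomial_poly j).
move=> n _ le_mu; rewrite /Nbullet mulrC divfK; last first.
  by rewrite pnatr_eq0 -lt0n fact_gt0.
rewrite (card_factorizations r lam hmu le_mu erefl) card_admissible.
rewrite natr_sum horner_sum; apply: eq_bigr => j _.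
by rewrite hornerZ binomial_polyE natrM mulrC.
Qed.
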